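(* Let $V$ be a finite set and let $R:V\times V\to 2^V$ be a poset function such that (p) for all $u,v,w\in V$: $w\in R(u,v)$ implies $R(u,w)\cup R(w,v)=R(u,v)$; and (hy) for all $x,y,v\in V$: if $R(x,v)\neq\emptyset$ and $R(y,v)\neq\emptyset$ then $x\in R(y,v)$ or $y\in R(x,v)$. Let $G_R$ be the underlying digraph of $R$ and $R_{G_R}$ the path transit function of $G_R$. Then $G_R$ is a directed rooted forest and $R_{G_R}=R$.
   Context: Let $V$ be a finite set. A directed transit function on $V$ is a function $R:V\times V\to 2^V$ satisfying (t0) for all $u,v,w\in V$: if $R(u,w)\neq\emptyset$ and $R(w,v)\neq\emptyset$ then $R(u,v)\neq\emptyset$; (t1) for all $u,v\in V$: if $R(u,v)\neq\emptyset$ then $\{u,v\}\subseteq R(u,v)$; (t3) $R(u,u)=\{u\}$ for all $u\in V$. A poset function is a directed transit function that in addition satisfies (t2a) for all $u,v\in V$: if $R(u,v)\neq\emptyset$ and $u\neq v$ then $R(v,u)=\emptyset$; (tr1) for all $u,v,w\in V$ with $u\neq v$: if $R(u,w)\neq\emptyset$ and $R(w,v)\neq\emptyset$ then $R(u,w)\cup R(w,v)\subseteq R(u,v)$; (tr2) for all $u,v,w\in V$ with $u\neq v$: if $R(u,w)=\emptyset$ or $R(w,v)=\emptyset$ then $w\notin R(u,v)$. The underlying digraph $G_R$ of $R$ has vertex set $V$, and $(x,y)$ is a directed edge of $G_R$ if and only if $x\neq y$ and $R(x,y)=\{x,y\}$. A directed path from $u$ to $v$ is a sequence $(x_0=u,x_1,\dots,x_n=v)$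 of pairwise distinct vertices with each $(x_{i-1},x_i)$ an edge; $n=0$ is allowed. For a digraph $G$ with vertex set $V$, the path transit function $R_G$ is $R_G(u,v)=\{x\in V\mid x \text{ lies on a directed path from } u \text{ to } v \text{ in } G\}$. In a directed acyclic graph (DAG), a hybrid vertex is a vertex with more than one incoming edge; a root is a vertex without incoming edges from which there is a directed path to every other vertex. A rooted (directed) tree is a DAG that contains a root and has no hybrid vertices. A (directed rooted) forest is a disjoint union of rooted trees. *)

(* Defs.v *)
From mathcomp Require Import all_boot.

Set Implicit Arguments.
Unset Strict Implicit.
Unset Printing Implicit Defensive.

Section Digraphs.

(* A digraph with vertex set V is given by its edge relation. *)
Variables (V : finType) (e : rel V).

(* The vertex sequence is u :: p. *)
Definition dipath (u v : V) (p : seq V) : bool :=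
  [&& path e u p, last u p == v & uniq (u :: p)].

(* Quantifying over sequences of length at most #|V| is no restriction, as
   the vertices of a directed path are pairwise distinct; see
   path_transitP. *)
Definition path_transit (u v : V) : {set V} :=
  [set x | [exists p : #|V|.-bseq V, dipath u v p && (x \in u :: p)]].

Lemma path_transitP u v x :
  reflect (exists2 p : seq V, dipath u v p & x \in u :: p)
          (x \in path_transit u v).
Proof.
rewrite inE; apply: (iffP existsP) => [[p /andP[]]|[p dp xp]]; first by exists p.
have sp : size p <= #|V|.
  by case/and3P: dp => _ _ /card_uniqP/= sz; apply: ltnW; rewrite -sz max_card.
by exists (Bseq sp); rewrite /= dp.
Qed.

(* Cycles of length 1 (loops) and 2 are excluded as well. *)
Definition dag : Prop := forall c : seq V, ucycle e c -> c = [::].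

Definition hybrid (x : V) : bool := 1 < #|[set y | e y x]|.

Definition root_vertex (r : V) : Prop :=
  (forall y, ~~ e y r) /\
  (forall x, x != r -> exists p : seq V, dipath r x p).

Definition rooted_tree : Prop :=
  [/\ dag, exists r, root_vertex r & forall x, ~~ hybrid x].

End Digraphs.

Definition induced_digraph (V : finType) (e : rel V) (S : {set V}) :
    rel {x : V | x \in S} :=
  fun x y => e (val x) (val y).

(* V is partitioned into nonempty blocks, no edge joins different blocks, and
   each block induces a rooted tree. *)
Definition rooted_forest (V : finType) (e : rel V) : Prop :=
  exists P : {set {set V}},
    partition P [set: V] /\
    (forall S, S \in P -> closed e S /\ rooted_tree (induced_digraph e (S := S))).

Section TransitFunctions.

Variables (V : finType) (R : V -> V -> {set V}).

Record directed_transit_function : Prop := DirectedTransitFunction {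
  transit_t0 : forall u v w,
    R u w != set0 -> R w v != set0 -> R u v != set0;
  transit_t1 : forall u v, R u v != set0 -> [set u; v] \subset R u v;
  transit_t3 : forall u, R u u = [set u]
}.

Record poset_function : Prop := PosetFunction {
  poset_transit : directed_transit_function;
  poset_t2a : forall u v, R u v != set0 -> u != v -> R v u = set0;
  poset_tr1 : forall u v w, u != v ->
    R u w != set0 -> R w v != set0 -> R u w :|: R w v \subset R u v;
  poset_tr2 : forall u v w, u != v ->
    R u w = set0 \/ R w v = set0 -> w \notin R u v
}.

Definition axiom_p : Prop :=
  forall u v w, w \in R u v -> R u w :|: R w v = R u v.

Definition axiom_hy : Prop :=
  forall x y v, R x v != set0 -> R y v != set0 ->
    x \in R y v \/ y \in R x v.

Definition underlying_digraph : rel V :=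
  fun x y => (x != y) && (R x y == [set x; y]).

End TransitFunctions.

(* Main.v *)
Require Import Defs.
From mathcomp Require Import all_boot.

(* A poset function is the interval function of the order [R x y != set0], and
   its underlying digraph is the covering relation of that order, so directed
   paths are saturated chains and the path transit function recovers the
   intervals.  Axiom (hy) says that the elements below a given vertex form a
   chain; hence a vertex covers at most one other and lies above exactly one
   minimal vertex, and the up-sets of the minimal vertices are the trees. *)

(** Closedness keeps every vertex of the path in [S], so the path lifts to the subtype. This is what
    lets the root of a block reach the whole block inside the induced digraph. *)
Lemma dipath_induced (V : finType) (e : rel V) (S : {set V})
    (x y : {v : V | v \in S}) (p : seq V) :
  closed e S -> dipath e (val x) (val y) p ->
  exists q, dipath (induced_digraph e (S := S)) x y q.
Proof.
move=> closedS /and3P[xp /eqP py uniq_p].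
have pS : all [in S] p.
  elim: p (val x) (valP x) xp {py uniq_p} => //= z p IHp w wS /andP[wz zp].
  have zS : z \in S by rewrite -(closedS _ _ wz).
  by rewrite zS (IHp z).
have [q p_def] : exists q : seq {v : V | v \in S}, p = map val q.
  exists (pmap insub p); rewrite pmap_filter; last exact: insubK.
  by apply/esym/all_filterP; apply: sub_all pS => z zS; rewrite /= insubT.
exists q; move: xp py uniq_p; rewrite p_def path_map last_map -map_cons.
rewrite (map_inj_uniq val_inj) => xq /val_inj qy uniq_q.
by apply/and3P; split=> //; apply/eqP.
Qed.

Section PosetFunction.

Variables (V : finType) (R : V -> V -> {set V}).
Hypothesis posetR : poset_function R.

Let transitR := poset_transit posetR.

Definition transit_le : rel V := fun x y => R x y != set0.

Definition transit_lt : rel V := fun x y => (x != y) && transit_le x y.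

Local Notation le := transit_le.
Local Notation lt := transit_lt.
Local Notation G := (underlying_digraph R).

Lemma transit_le_refl : reflexive le.
Proof.
by move=> x; apply/set0Pn; exists x; rewrite (transit_t3 transitR) set11.
Qed.

Lemma transit_le_trans : transitive le.
Proof. by move=> w u v; apply: transit_t0. Qed.

Lemma transit_le_anti x y : le x y -> le y x -> x = y.
Proof.
move=> xy yx; apply/eqP/negPn/negP => /(poset_t2a posetR xy) R0.
by move: yx; rewrite /transit_le R0 eqxx.
Qed.

(** For [u != v], (tr2) gives one direction and (tr1) with (t1) the other. For [u = v], the interval
    is a singleton by (t3) and the claim is antisymmetry. *)
Lemma mem_transit u v w : (w \in R u v) = le u w && le w v.
Proof.
have [<-|uv] := eqVneq u v.
  rewrite (transit_t3 transitR) inE.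
  apply/eqP/andP=> [->|[uw wu]]; first by rewrite transit_le_refl.
  exact: transit_le_anti.
apply/idP/andP=> [wuv|[uw wv]].
  split; apply: contraTneq wuv => R0; apply: (poset_tr2 posetR) => //.
    by left.
  by right.
apply: (subsetP (poset_tr1 posetR uv uw wv)).
rewrite inE; apply/orP; left.
by apply: (subsetP (transit_t1 transitR uw)); rewrite !inE eqxx orbT.
Qed.

Lemma transit_lt_irrefl : irreflexive lt.
Proof. by move=> x; rewrite /transit_lt eqxx. Qed.

Lemma transit_lt_trans : transitive lt.
Proof.
move=> y x z /andP[xy lexy] /andP[_ leyz].
rewrite /transit_lt (transit_le_trans _ _ _ lexy leyz) andbT.
apply: contraNneq xy => xz; apply/eqP.
by apply: transit_le_anti lexy _; rewrite xz.
Qed.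

Lemma underlying_digraph_lt : subrel G lt.
Proof.
move=> x y /andP[xy /eqP Rxy]; rewrite /transit_lt xy.
by apply/set0Pn; exists x; rewrite Rxy set21.
Qed.

Lemma path_underlying_le u p x : path G u p -> x \in u :: p -> le u x.
Proof.
move=> /(sub_path underlying_digraph_lt).
rewrite (path_sortedE transit_lt_trans) => /andP[/allP up _].
rewrite inE => /predU1P[->|/up/andP[] //]; exact: transit_le_refl.
Qed.

(** Edges go strictly up in the order, so no vertex can recur. *)
Lemma path_underlying_uniq u p : path G u p -> uniq (u :: p).
Proof.
move=> /(sub_path underlying_digraph_lt).
exact: (sorted_uniq transit_lt_trans transit_lt_irrefl (s := u :: p)).
Qed.

(** Induction on the size of the interval: unless [(u, v)] is an edge, the interval has a third
    element [w], and [R u w] and [R w v] are strictly smaller, missing [v] and [u] respectively. *)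
Lemma transit_le_path u v : le u v -> exists p, dipath G u v p.
Proof.
suff path_ex: le u v -> exists2 p, path G u p & last u p = v.
  move=> /path_ex[p up <-]; exists p.
  by rewrite /dipath up eqxx path_underlying_uniq.
have [n] := ubnP #|R u v|; elim: n u v => // n IHn u v Rn uv.
have [<-|neq_uv] := eqVneq u v; first by exists [::].
have [edge_uv|not_edge] := boolP (R u v == [set u; v]).
  by exists [:: v] => //=; rewrite /underlying_digraph neq_uv edge_uv.
have /subsetPn[w wR] : ~~ (R u v \subset [set u; v]).
  by apply: contra not_edge => sR; rewrite eqEsubset sR (transit_t1 transitR).
rewrite !inE negb_or => /andP[wu wv].
move: wR; rewrite mem_transit => /andP[le_uw le_wv].
have Ruw : R u w \proper R u v.
  apply/properP; split.
    apply/subsetP=> z; rewrite !mem_transit => /andP[-> zw].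
    exact: transit_le_trans le_wv.
  exists v; first by rewrite mem_transit uv transit_le_refl.
  rewrite mem_transit uv; apply: contra wv => vw.
  by apply/eqP; apply: transit_le_anti.
have Rwv : R w v \proper R u v.
  apply/properP; split.
    apply/subsetP=> z; rewrite !mem_transit => /andP[wz ->]; rewrite andbT.
    exact: transit_le_trans wz.
  exists u; first by rewrite mem_transit uv transit_le_refl.
  rewrite mem_transit uv andbT; apply: contra wu => wu.
  by apply/eqP; apply: transit_le_anti.
have [||p pu lp] := IHn u w => //; first exact: leq_trans (proper_card Ruw) _.
have [||q qw lq] := IHn w v => //; first exact: leq_trans (proper_card Rwv) _.
by exists (p ++ q); rewrite ?cat_path ?last_cat lp ?pu.
Qed.

Lemma path_transit_underlying : path_transit G =2 R.
Proof.
move=> u v; apply/setP=> x; rewrite mem_transit.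
apply/path_transitP/andP=> [[p /and3P[up /eqP pv _] xp]|[ux xv]].
  split; first exact: path_underlying_le xp.
  (* Cut the path at [x]; the second piece shows that [x] is below [v]. *)
  move: xp up pv; case/splitPl: p / => p1 p2 p1x.
  rewrite cat_path p1x last_cat p1x => /andP[_ xp2] <-.
  exact: path_underlying_le (mem_last _ _).
have [p /and3P[up /eqP px _]] := transit_le_path _ _ ux.
have [q /and3P[xq /eqP qv _]] := transit_le_path _ _ xv.
have upq : path G u (p ++ q) by rewrite cat_path up px.
exists (p ++ q); last by rewrite -cat_cons mem_cat -px mem_last.
by rewrite /dipath upq last_cat px qv eqxx path_underlying_uniq.
Qed.

Lemma induced_underlying_dag (S : {set V}) :
  dag (induced_digraph G (S := S)).
Proof.
case=> // x p /andP[/= cyc _].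
(* Unrolled, a cycle is a strictly increasing chain from [x] back to [x]. *)
have : path lt (val x) (map val (rcons p x)).
  by rewrite path_map; apply: sub_path cyc => y z; apply: underlying_digraph_lt.
rewrite (path_sortedE transit_lt_trans) => /andP[/allP/(_ (val x))].
by rewrite map_f ?mem_rcons ?mem_head // transit_lt_irrefl => /(_ isT).
Qed.

(** Having the fewest elements below it forces minimality in the order. The default [v] is itself a
    candidate by reflexivity. *)
Definition transit_root (v : V) : V :=
  [arg min_(r < v | le r v) #|[set z | le z r]|].

Lemma transit_root_le v : le (transit_root v) v.
Proof.
by rewrite /transit_root; case: arg_minnP => //; apply: transit_le_refl.
Qed.

Lemma transit_root_min v y : le y (transit_root v) -> y = transit_root v.
Proof.
rewrite /transit_root; case: arg_minnP => [|r rv rmin yr].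
  exact: transit_le_refl.
apply/eqP/negPn/negP=> neq_yr.
have := rmin y (transit_le_trans _ _ _ yr rv); rewrite leqNgt => /negP; apply.
(* The down-set of [y] is contained in that of [r] and misses [r], against the choice of [r]. *)
apply/proper_card/properP; split.
  by apply/subsetP=> z; rewrite !inE => zy; apply: transit_le_trans yr.
exists r; rewrite !inE ?transit_le_refl //.
by apply: contra neq_yr => ry; apply/eqP; apply: transit_le_anti.
Qed.

Hypothesis hyR : axiom_hy R.

Lemma transit_le_chain x y v : le x v -> le y v -> le x y \/ le y x.
Proof.
by move=> xv yv; case: (hyR _ _ _ xv yv); rewrite mem_transit => /andP[? _];
  [right | left].
Qed.

(** Both intervals consist of their endpoints only, so (hy) leaves [x = y] or an endpoint equal to
    [v], and edges are not loops. *)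
Lemma underlying_pred_unique x y v : G x v -> G y v -> x = y.
Proof.
move=> xv yv.
have /andP[neq_xv le_xv] := underlying_digraph_lt _ _ xv.
have /andP[neq_yv le_yv] := underlying_digraph_lt _ _ yv.
case/andP: xv => _ /eqP Rxv; case/andP: yv => _ /eqP Ryv.
case: (hyR _ _ _ le_xv le_yv); rewrite ?Rxv ?Ryv !inE => /orP[]/eqP // E.
  by rewrite E eqxx in neq_xv.
by rewrite E eqxx in neq_yv.
Qed.

(** Both roots lie below [v], hence are comparable, and both are minimal. *)
Lemma transit_le_root u v : le u v -> transit_root u = transit_root v.
Proof.
move=> uv.
have ruv := transit_le_trans _ _ _ (transit_root_le u) uv.
by case: (transit_le_chain _ _ _ ruv (transit_root_le v)) =>
  [/transit_root_min | /transit_root_min/esym].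
Qed.

Lemma induced_underlying_hybrid (S : {set V}) x :
  ~~ hybrid (induced_digraph G (S := S)) x.
Proof.
rewrite /hybrid -leqNgt; apply/card_le1_eqP=> y z; rewrite !inE => yx zx.
by apply: val_inj; apply: (underlying_pred_unique _ _ (val x)).
Qed.

Lemma underlying_rooted_forest : rooted_forest G.
Proof.
(* The blocks are the fibres of [transit_root]; an edge joins comparable vertices, so it stays
   within one fibre. *)
exists (preim_partition transit_root [set: V]).
split=> [|S]; first exact: preim_partitionP.
case/imsetP=> x _ S_def.
have memS y : (y \in S) = (transit_root x == transit_root y).
  by rewrite S_def !inE.
have closedS : closed G S.
  move=> y z /underlying_digraph_lt/andP[_ /transit_le_root yz].
  by rewrite !memS yz.
split=> //; split;
  [exact: induced_underlying_dag | | exact: induced_underlying_hybrid].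
have rS : transit_root x \in S.
  by rewrite memS (transit_le_root _ _ (transit_root_le x)).
(* The root of the block is the common value of [transit_root] on it. *)
exists (exist [in S] _ rS); split=> [y|y _].
  apply/negP=> /underlying_digraph_lt/andP[/= neq_yr yr].
  by rewrite (transit_root_min _ _ yr) eqxx in neq_yr.
have ry : le (transit_root x) (val y).
  by have := valP y; rewrite /= memS => /eqP->; apply: transit_root_le.
have [p] := transit_le_path _ _ ry.
exact: (dipath_induced _ _ _ (exist [in S] _ rS) y).
Qed.

End PosetFunction.

Theorem theorem23 (V : finType) (R : V -> V -> {set V}) :
  poset_function R -> axiom_p R -> axiom_hy R ->
  rooted_forest (underlying_digraph R) /\
  path_transit (underlying_digraph R) =2 R.
Proof.
move=> posetR _ hyR; split; first exact: underlying_rooted_forest.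
exact: path_transit_underlying.
Qed.
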